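(* Let $P(\bar x)$ be any quantifier-free formula of $\mathbf{G}^\Delta$ with free variables among $\bar x$. If $\models\exists\bar x\,P(\bar x)$, then there exist tuples $\bar t_1,\dots,\bar t_n$ of terms in the Herbrand universe $U(P)$ such that $\models\bigvee_{i=1}^n P(\bar t_i)$.
   Context: Formulas of first-order Gödel logic with $\Delta$ ($\mathbf{G}^\Delta$) are built from atoms $p(t_1,\dots,t_n)$ ($p$ a predicate symbol, $t_i$ first-order terms; there is no equality), the truth constants $\bot,\top$, the binary connectives $\wedge,\vee,\to$, the unary operator $\Delta$ and the quantifiers $\forall,\exists$; $\neg A$ abbreviates $A\to\bot$. An interpretation $\mathcal I$ consists of a nonempty domain $D$ and a valuation assigning elements of $D$ to constants and variables, functions $D^n\to D$ to $n$-ary function symbols, and functions $D^n\to[0,1]$ to $n$-ary predicate symbols. The truth value $v_{\mathcal I}$ is defined by: an atom gets the value of the predicate's function at the values of its arguments; $v_{\mathcal I}(\bot)=0$, $v_{\mathcal I}(\top)=1$; $v_{\mathcal I}(A\wedge B)=\min$, $v_{\mathcal I}(A\vee B)=\max$ of the values; $v_{\mathcal I}(A\to B)=1$ if $v_{\mathcal I}(A)\le v_{\mathcal I}(B)$ and $=v_{\mathcal I}(B)$ otherwise; $v_{\mathcal I}(\Delta A)=1$ if $v_{\mathcal I}(A)=1$ and $0$ otherwise; $v_{\mathcal I}(\forall xA)=\inf_{d\in D}v_{\mathcal I[d/x]}(A)$ and $v_{\mathcal I}(\exists xA)=\sup_{d\in D}v_{\mathcal I[d/x]}(A)$, where $\mathcal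 I[d/x]$ is $\mathcal I$ with $x$ assigned $d$. A formula $A$ is valid, written $\models A$, if $v_{\mathcal I}(A)=1$ for every interpretation $\mathcal I$. The Herbrand universe $U(P)$ of $P$ is the set of all variable-free terms built from the constants and function symbols occurring in $P$, where a constant and a function symbol of positive arity are added if no such symbols occur in $P$ (so $U(P)$ is infinite). *)

(* Defs.v *)
From mathcomp Require Import all_boot all_order all_algebra.
From mathcomp Require Import all_classical all_reals.

Set Implicit Arguments.
Unset Strict Implicit.
Unset Printing Implicit Defensive.

Import Order.TTheory GRing.Theory Num.Theory.
Local Open Scope ring_scope.

(* The constants are the function symbols of arity 0. *)
Record signature := Signature {
  funsym : Type;
  farity : funsym -> nat;
  predsym : Type;
  parity : predsym -> nat }.

(* n-tuples of terms, and of elements of a domain, are functions on 'I_n;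
   variables are natural numbers. *)
Inductive term (S : signature) : Type :=
| Var of nat
| App (f : funsym S) of ('I_(farity f) -> term S).

Arguments Var {S}.

Inductive formula (S : signature) : Type :=
| Atom (p : predsym S) of ('I_(parity p) -> term S)
| Bot
| Top
| And of formula S & formula S
| Or of formula S & formula S
| Imp of formula S & formula S
| Delta of formula S
| Forall of nat & formula S
| Exists of nat & formula S.

Arguments Bot {S}.
Arguments Top {S}.

Section Syntax.
Variable S : signature.
Implicit Types (t : term S) (A B : formula S) (f : funsym S).

Fixpoint quantifier_free A : bool :=
  match A with
  | Atom _ _ | Bot | Top => true
  | And B C | Or B C | Imp B C => quantifier_free B && quantifier_free C
  | Delta B => quantifier_free B
  | Forall _ _ | Exists _ _ => false
  end.

Fixpoint var_in_term (x : nat) t : Prop :=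
  match t with
  | Var y => x = y
  | App f a => exists i, var_in_term x (a i)
  end.

Fixpoint free_in (x : nat) A : Prop :=
  match A with
  | Atom p a => exists i, var_in_term x (a i)
  | Bot | Top => False
  | And B C | Or B C | Imp B C => free_in x B \/ free_in x C
  | Delta B => free_in x B
  | Forall y B | Exists y B => x <> y /\ free_in x B
  end.

Fixpoint funsym_in_term f t : Prop :=
  match t with
  | Var _ => False
  | App g a => f = g \/ exists i, funsym_in_term f (a i)
  end.

Fixpoint funsym_in f A : Prop :=
  match A with
  | Atom p a => exists i, funsym_in_term f (a i)
  | Bot | Top => False
  | And B C | Or B C | Imp B C => funsym_in f B \/ funsym_in f C
  | Delta B | Forall _ B | Exists _ B => funsym_in f B
  end.

Definition update (T : Type) (v : nat -> T) (x : nat) (d : T) : nat -> T :=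
  fun y => if y == x then d else v y.

Fixpoint subst_term (s : nat -> term S) t : term S :=
  match t with
  | Var y => s y
  | App f a => App (fun i => subst_term s (a i))
  end.

(* Bound variables are not renamed: this is the usual substitution when A is
   quantifier-free or when the substituted terms are variable-free. *)
Fixpoint subst (s : nat -> term S) A : formula S :=
  match A with
  | Atom p a => Atom (fun i => subst_term s (a i))
  | Bot => Bot
  | Top => Top
  | And B C => And (subst s B) (subst s C)
  | Or B C => Or (subst s B) (subst s C)
  | Imp B C => Imp (subst s B) (subst s C)
  | Delta B => Delta (subst s B)
  | Forall y B => Forall y (subst (update s y (Var y)) B)
  | Exists y B => Exists y (subst (update s y (Var y)) B)
  end.

(* Simultaneous substitution of ts for xs; a variable y that is not in xs has
   index m in xs, hence is left unchanged. *)
Definition inst (m : nat) (A : formula S) (xs : m.-tuple nat)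
    (ts : m.-tuple (term S)) : formula S :=
  subst (fun y => nth (Var y) ts (index y xs)) A.

Definition exists_closure (xs : seq nat) A : formula S :=
  foldr (@Exists S) A xs.

Fixpoint disjunction (s : seq (formula S)) : formula S :=
  match s with
  | [::] => Bot
  | [:: A] => A
  | A :: s' => Or A (disjunction s')
  end.

(* c is the constant added when P contains no constant, and h the function
   symbol of positive arity added when P contains none. *)
Definition herbrand_symbol (c h : funsym S) (P : formula S) f : Prop :=
  [\/ funsym_in f P,
      f = c /\ ~ (exists2 g, funsym_in g P & farity g = 0%N) |
      f = h /\ ~ (exists2 g, funsym_in g P & (0 < farity g)%N)].

Inductive herbrand_universe (c h : funsym S) (P : formula S) : term S -> Prop :=
| HerbrandApp f (a : 'I_(farity f) -> term S) :
    herbrand_symbol c h P f ->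
    (forall i, herbrand_universe c h P (a i)) ->
    herbrand_universe c h P (App a).

End Syntax.

Section Semantics.
Variables (R : realType) (S : signature).

(* An interpretation is a structure M together with a valuation
   v : nat -> dom M of the variables; the existence of v makes the domain
   nonempty. *)
Record structure := Structure {
  dom : Type;
  fint : forall f : funsym S, ('I_(farity f) -> dom) -> dom;
  pint : forall p : predsym S, ('I_(parity p) -> dom) -> R;
  pint01 : forall (p : predsym S) (a : 'I_(parity p) -> dom),
    0 <= pint a <= 1 }.

Fixpoint term_value (M : structure) (v : nat -> dom M) (t : term S) : dom M :=
  match t with
  | Var x => v x
  | App f a => fint (fun i => term_value v (a i))
  end.

Fixpoint value (M : structure) (v : nat -> dom M) (A : formula S) : R :=
  match A with
  | Atom p a => pint (fun i => term_value v (a i))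
  | Bot => 0
  | Top => 1
  | And B C => Num.min (value v B) (value v C)
  | Or B C => Num.max (value v B) (value v C)
  | Imp B C => if value v B <= value v C then 1 else value v C
  | Delta B => if value v B == 1 then 1 else 0
  | Forall x B => inf (range (fun d : dom M => value (update v x d) B))
  | Exists x B => sup (range (fun d : dom M => value (update v x d) B))
  end.

Definition valid (A : formula S) : Prop :=
  forall (M : structure) (v : nat -> dom M), value v A = 1.

End Semantics.

(* Main.v *)
Require Import Defs.
From mathcomp Require Import all_boot all_order all_algebra.
From mathcomp Require Import all_classical all_reals.

(* If no finite disjunction of Herbrand instances is valid, enumerate the
   instances and take for each k an interpretation giving the first k of them
   values below 1. An ultrafilter on the indices k turns these values into a
   total preorder on formulas. Truth values in Goedel logic with Delta depend
   only on the order of the values of the atoms relative to 0 and 1, so any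
   order-preserving map of this preorder into [0,1] defines a Herbrand model.
   Only countably many formulas matter, hence the map can be chosen so that
   every formula not equivalent to the top gets value at most 1/2. In that
   model all instances, and therefore their supremum, are at most 1/2. *)

Set Implicit Arguments.
Unset Strict Implicit.
Unset Printing Implicit Defensive.

Import Order.TTheory GRing.Theory Num.Theory.
Local Open Scope ring_scope.
Local Open Scope classical_set_scope.

(** * Countable sets and a geometric sum *)

Lemma countable_enum (T : Type) (A : set T) (x0 : T) :
  countable A -> A x0 ->
  exists2 e : nat -> T, forall n, A (e n) & A `<=` range e.
Proof.
move=> /countable_injP[f f_inj] Ax0.
(* Each [n] outside the image of [f] is sent to [x0], so finite sets are covered too. *)
have /choice[e eP] : forall n, exists x,
    A x /\ (forall y, A y -> f y = n -> y = x).
  move=> n; have [[x [Ax fx]]|nex] := pselect (exists x, A x /\ f x = n).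
    exists x; split=> // y Ay fy.
    by apply: f_inj; rewrite ?inE // fx fy.
  by exists x0; split=> // y Ay fy; case: nex; exists y.
exists e => [n|x Ax]; first by case: (eP n).
by exists (f x) => //; have [_ /(_ x Ax erefl)] := eP (f x).
Qed.

Lemma countableU (T : Type) (A B : set T) :
  countable A -> countable B -> countable (A `|` B).
Proof.
move=> cA cB; apply: (@sub_countable _ _ _
  (\bigcup_(b in [set: bool]) if b then A else B)).
  by apply: subset_card_le => x [Ax|Bx]; [exists true|exists false].
by apply: bigcup_countable => // -[].
Qed.

Lemma countable_image (T U : Type) (f : T -> U) (A : set T) :
  countable A -> countable (f @` A).
Proof. by apply: sub_countable; exact: card_image_le. Qed.

Lemma sum_half_powers_le (R : realType) (n : nat) :
  \sum_(j < n) (2^-1 : R) ^+ j.+2 <= 2^-1.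
Proof.
suff -> : \sum_(j < n) (2^-1 : R) ^+ j.+2 = 2^-1 - 2^-1 ^+ n.+1.
  by rewrite lerBlDr lerDl exprn_ge0 // invr_ge0.
elim: n => [|n IHn]; first by rewrite big_ord0 expr1 subrr.
rewrite big_ord_recr /= IHn -addrA; congr (_ + _).
rewrite [X in - X + _](_ : _ = 2^-1 ^+ n.+2 + 2^-1 ^+ n.+2).
  by rewrite opprD addrNK.
by rewrite -mulr2n [in RHS]exprSr -mulrnAr -[2^-1 *+ 2]mulr_natr mulVf ?mulr1 ?pnatr_eq0.
Qed.

(** * Embedding a total preorder into the unit interval *)

Section PreorderEmbedding.
Variables (R : realType) (T : Type) (le : T -> T -> Prop) (e : nat -> T).
Hypotheses (leT_trans : forall x y z, le x y -> le y z -> le x z)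
  (leT_total : forall x y, le x y \/ le y x).

(** Each [e j] strictly below [x] contributes a fixed positive weight to the height of [x]. The
    exponents start at 2, which keeps the total at or below 1/2. *)
Let weight j x : R := if `[< ~ le x (e j) >] then 2^-1 ^+ j.+2 else 0.
Let partial n x : R := \sum_(j < n) weight j x.
Let height x : R := sup (range (partial^~ x)).

Let weight_ge0 j x : 0 <= weight j x.
Proof. by rewrite /weight; case: ifP => // _; rewrite exprn_ge0 // invr_ge0. Qed.

Let weight_le j x y : le x y -> weight j x <= weight j y.
Proof.
move=> xy; rewrite /weight; case: asboolP => nx.
  rewrite ifT //; apply/asboolP => yj; exact/nx/(leT_trans xy).
by case: ifP => // _; rewrite exprn_ge0 // invr_ge0.
Qed.

Let partial_le_half n x : partial n x <= 2^-1.
Proof.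
apply: le_trans (sum_half_powers_le R n); apply: ler_sum => j _.
by rewrite /weight; case: ifP => // _; rewrite exprn_ge0 // invr_ge0.
Qed.

Let partial_le_height n x : partial n x <= height x.
Proof.
apply: ub_le_sup; last by exists n.
by exists 2^-1 => _ [k _ <-]; exact: partial_le_half.
Qed.

Let height_le x b : (forall n, partial n x <= b) -> height x <= b.
Proof. by move=> xb; apply: ge_sup => [|_ [k _ <-]//]; exists (partial 0 x), 0%N. Qed.

Let height_mono x y : le x y -> height x <= height y.
Proof.
move=> xy; apply: height_le => n; apply: le_trans (partial_le_height n y).
by apply: ler_sum => j _; exact: weight_le.
Qed.

(** The weight of index [i] counts for [x] but not for [e i] itself, and all other weights are
    monotone; so the heights differ by at least that weight. *)
Let height_strict i x : ~ le x (e i) -> height (e i) < height x.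
Proof.
move=> nxi.
have ix : le (e i) x by have [] := leT_total x (e i).
suff : height (e i) <= height x - 2^-1 ^+ i.+2.
  by move=> /le_lt_trans; apply; rewrite ltrBlDr ltrDl exprn_gt0 // invr_gt0.
apply: height_le => n; rewrite lerBrDr.
(* The partial sum is lengthened so that index [i] occurs in it. *)
apply: le_trans (partial_le_height (n + i.+1) x).
have in_i : (i < n + i.+1)%N by rewrite addnS ltnS leq_addl.
rewrite {2}/partial (bigD1 (Ordinal in_i)) //= addrC.
have -> : weight i x = 2^-1 ^+ i.+2 by rewrite /weight ifT //; exact/asboolP.
rewrite lerD2r; apply: (@le_trans _ _ (partial (n + i.+1) (e i))).
  by rewrite /partial big_split_ord /= lerDl sumr_ge0.
rewrite /partial (bigD1 (Ordinal in_i)) //=.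
have -> : weight i (e i) = 0.
  rewrite /weight ifF //; apply/negbTE/asboolPn => -[].
  by case: (leT_total (e i) (e i)).
by rewrite add0r; apply: ler_sum => j _; exact: weight_le.
Qed.

(* The gap between [1/2] and [1] keeps the supremum of the Herbrand instances
   away from [1]. *)
Lemma preorder_embedding (bot top : T) :
  (forall x, le bot x) -> (forall x, le x top) -> ~ le top bot ->
  exists F : T -> R,
    [/\ F bot = 0, forall x, le top x -> F x = 1,
        forall x, ~ le top x -> F x <= 2^-1,
        forall x y, le x y -> F x <= F y &
        forall i x, ~ le x (e i) -> F (e i) < F x].
Proof.
move=> le0 le1 n10.
exists (fun x => if `[< le top x >] then 1 else height x).
have h_half x : height x <= 2^-1 by exact: height_le.
have half_lt1 : 2^-1 < 1 :> R by rewrite invf_lt1 // ltr1n.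
split.
- rewrite /= ifF; last exact/negbTE/asboolPn.
  apply/le_anti/andP; split.
    apply: height_le => n; rewrite /partial big1 // => j _.
    by rewrite /weight ifF //; apply/negbTE/asboolPn; case.
  by have := partial_le_height 0 bot; rewrite /partial big_ord0.
- by move=> x tx /=; rewrite ifT //; exact/asboolP.
- by move=> x tx /=; rewrite ifF //; exact/negbTE/asboolPn.
- move=> x y xy /=; case: asboolP => tx.
    by rewrite ifT //; apply/asboolP; exact: leT_trans xy.
  by case: asboolP => _; [exact: le_trans (ltW half_lt1) | exact: height_mono].
- move=> i x nxi /=; rewrite ifF; last first.
    by apply/negbTE/asboolPn => ti; apply: nxi; exact: leT_trans ti.
  by case: asboolP => _; [exact: le_lt_trans half_lt1 | exact: height_strict].
Qed.

End PreorderEmbedding.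

(** * Countability of the Herbrand universe *)

Section Enumeration.
Variable S : signature.
Implicit Types (A B P : formula S) (t : term S).

Lemma countable_funsym_in_term t : countable [set f | funsym_in_term f t].
Proof.
elim: t => //= g a IHa.
rewrite [X in countable X](_ : _ =
    [set g] `|`
    \bigcup_(i in [set: 'I_(farity g)]) [set f | funsym_in_term f (a i)]).
  by apply: countableU => //; apply: bigcup_countable.
apply/seteqP; split=> f /=.
  by case=> [->|[i fi]]; [left|right; exists i].
by case=> [->|[i _ fi]]; [left|right; exists i].
Qed.

Lemma countable_funsym_in A : countable [set f | funsym_in f A].
Proof.
elim: A => //= [p a|B IHB C IHC|B IHB C IHC|B IHB C IHC].
- rewrite [X in countable X](_ : _ =
    \bigcup_(i in [set: 'I_(parity p)]) [set f | funsym_in_term f (a i)]).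
    by apply: bigcup_countable => // i _; exact: countable_funsym_in_term.
  by apply/seteqP; split=> f /= [i]; [exists i|move=> _ fi; exists i].
- exact: countableU IHB IHC.
- exact: countableU IHB IHC.
- exact: countableU IHB IHC.
Qed.

Lemma countable_herbrand_symbol (c h : funsym S) P :
  countable [set f | herbrand_symbol c h P f].
Proof.
apply: (@sub_countable _ _ _ ([set f | funsym_in f P] `|` ([set c] `|` [set h]))).
  apply: subset_card_le => f [fP|[-> _]|[-> _]]; first by left.
  - by right; left.
  - by right; right.
apply: countableU; first exact: countable_funsym_in.
exact: countableU.
Qed.

(** Trees labelled by numbers form a countable type, so decoding them gives countably many terms,
    even when [funsym S] is uncountable. *)
Fixpoint term_of_tree (e : nat -> funsym S) (g : GenTree.tree nat) : term S :=
  match g with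
  | GenTree.Leaf x => Var x
  | GenTree.Node n s =>
      let ts := [seq term_of_tree e g' | g' <- s] in
      App (fun i : 'I_(farity (e n)) => nth (Var 0%N) ts i)
  end.

Lemma countable_herbrand_universe (c h : funsym S) P f0 :
  herbrand_symbol c h P f0 -> countable (herbrand_universe c h P).
Proof.
move=> /(countable_enum (countable_herbrand_symbol c h P))[e _ e_surj].
apply: (@sub_countable _ _ _ (term_of_tree e @` setT)).
  2: exact: countable_image.
apply: subset_card_le => t; elim=> f + /e_surj[n _ fE]; case: _ / fE => a _ IHa.
have /choice[g gE] : forall i, exists g, term_of_tree e g = a i.
  by move=> i; have [g _ <-] := IHa i; exists g.
exists (GenTree.Node n [seq g i | i <- enum 'I_(farity (e n))]) => //=.
congr App; apply/funext => i; rewrite -gE.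
by rewrite -map_comp (nth_map i) ?size_enum_ord // nth_ord_enum.
Qed.

(* A strict inequality between the limit values has to be preserved only at
   consequents of implications. *)
Fixpoint imp_consequents A : set (formula S) :=
  match A with
  | And B C | Or B C => imp_consequents B `|` imp_consequents C
  | Imp B C => [set C] `|` (imp_consequents B `|` imp_consequents C)
  | Delta B => imp_consequents B
  | _ => set0
  end.

Lemma countable_imp_consequents A : countable (imp_consequents A).
Proof.
elim: A => //= B IHB C IHC; do ?exact: countableU.
by apply: countableU => //; exact: countableU.
Qed.

End Enumeration.

(** * Bounds on truth values, and Herbrand models *)

Section Values.
Variables (R : realType) (S : signature).
Implicit Types (A B P : formula S) (M : structure R S).

Lemma value01 M (v : nat -> dom M) A : 0 <= value v A <= 1.
Proof.
elim: A v => [p a|||B IHB C IHC|B IHB C IHC|B IHB C IHC|B IHB|x B IHB|x B IHB] v /=.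
- exact: pint01.
- by rewrite lexx ler01.
- by rewrite lexx ler01.
- by rewrite minEle; case: ifP.
- by rewrite maxEle; case: ifP.
- by case: ifP; rewrite // lexx ler01.
- by case: ifP; rewrite lexx ler01.
- set E := (X in inf X).
  have E0 : E (value (update v x (v x)) B) by exists (v x).
  apply/andP; split.
    apply: lb_le_inf => [|_ [d _ <-]]; first by eexists; exact: E0.
    by case/andP: (IHB (update v x d)).
  case/andP: (IHB (update v x (v x))) => _; apply: le_trans.
  apply: ge_inf => //; exists 0 => _ [d _ <-].
  by case/andP: (IHB (update v x d)).
- set E := (X in sup X).
  have E0 : E (value (update v x (v x)) B) by exists (v x).
  have ubE : ubound E 1 by move=> _ [d _ <-]; case/andP: (IHB (update v x d)).
  apply/andP; split; last by apply: ge_sup => //; eexists; exact: E0.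
  case/andP: (IHB (update v x (v x))) => B0 _; apply: le_trans B0 _.
  by apply: ub_le_sup => //; exists 1.
Qed.

Lemma value_ge0 M (v : nat -> dom M) A : 0 <= value v A.
Proof. by case/andP: (value01 v A). Qed.

Lemma value_le1 M (v : nat -> dom M) A : value v A <= 1.
Proof. by case/andP: (value01 v A). Qed.

Lemma value_exists_closure_le M (v : nat -> dom M) xs A b :
  (forall w : nat -> dom M, value w A <= b) -> value v (exists_closure xs A) <= b.
Proof.
move=> Ab; elim: xs v => [|x xs IHxs] v //=.
apply: ge_sup => [|_ [d _ <-]]; last exact: IHxs.
by exists (value (update v x (v x)) (exists_closure xs A)); exists (v x).
Qed.

Lemma value_disjunction_lt1 M (v : nat -> dom M) (I : eqType) (s : seq I)
    (f : I -> formula S) i :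
  value v (disjunction [seq f j | j <- s]) <> 1 -> i \in s -> value v (f i) < 1.
Proof.
move=> d1; have : value v (disjunction [seq f j | j <- s]) < 1.
  by rewrite lt_neqAle value_le1 andbT; exact/eqP.
elim: s {d1} => // j [|k s] IHs /=; first by rewrite inE => ? /eqP ->.
rewrite gt_max => /andP[j1 s1]; rewrite inE => /predU1P[-> //|].
exact: IHs.
Qed.

(* A homomorphic retraction of the terms onto the closed terms over [hs]
   (including the default [d]): through it all terms can serve as the domain of
   a Herbrand model, so no subtype of the Herbrand universe is needed. *)
Fixpoint ground (hs : set (funsym S)) (d : term S) (t : term S) : term S :=
  match t with
  | Var _ => d
  | App f a => if `[< hs f >] then App (fun i => ground hs d (a i)) else d
  end.

Lemma herbrand_universe_ground (c h : funsym S) P d t :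
  herbrand_universe c h P d ->
  herbrand_universe c h P (ground [set f | herbrand_symbol c h P f] d t).
Proof. by move=> Ud; elim: t => //= f a IHa; case: asboolP => // hf; constructor. Qed.

(** Function symbols act freely on terms; grounding happens only when an atom is evaluated. *)
Definition herbrand_model (hs : set (funsym S)) (d : term S) (F : formula S -> R)
    (F01 : forall A, 0 <= F A <= 1) : structure R S :=
  @Structure R S (term S) (@App S)
    (fun p a => F (Atom (fun i => ground hs d (a i)))) (fun _ _ => F01 _).

(** [ground] commutes with the symbols in [hs], so it can be pushed down to the variables. *)
Lemma ground_term_value hs d F (F01 : forall A, 0 <= F A <= 1)
    (v s : nat -> term S) t :
  (forall f, funsym_in_term f t -> hs f) ->
  (forall y, var_in_term y t -> ground hs d (v y) = s y) ->
  ground hs d (@term_value _ _ (herbrand_model hs d F01) v t) = subst_term s t.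
Proof.
elim: t => [y|f a IHa] /= hf vs; first exact: vs.
rewrite ifT; last by apply/asboolP; apply: hf; left.
congr App; apply/funext => i; apply: IHa => [g gi|y yi].
  by apply: hf; right; exists i.
by apply: vs; exists i.
Qed.

End Values.

(** * The ultrafilter preorder and the truth lemma *)

Section Ultralimit.
Variables (R : realType) (S : signature).
Variables (M : nat -> structure R S) (v : forall k, nat -> dom (M k)).
Variables (U : set_system nat) (U_ultra : UltraFilter U).
Implicit Types (A B C : formula S).

Definition ultra_le A B : Prop := U [set k | value (v k) A <= value (v k) B].

Lemma ultra_leW A B :
  (forall k, value (v k) A <= value (v k) B) -> ultra_le A B.
Proof. by move=> AB; exact: filterE. Qed.

Lemma ultra_le_trans A B C : ultra_le A B -> ultra_le B C -> ultra_le A C.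
Proof. by apply: filterS2 => k; exact: le_trans. Qed.

Lemma ultra_le_total A B : ultra_le A B \/ ultra_le B A.
Proof.
have [|nAB] := in_ultra_setVsetC [set k | value (v k) A <= value (v k) B] U_ultra.
  by left.
right; apply: filterS nAB => k /negP; rewrite -ltNge; exact: ltW.
Qed.

Lemma ultra_lt A : U [set k | value (v k) A < 1] -> ~ ultra_le Top A.
Proof.
move=> A1 le1A; apply: (filter_not_empty U).
by apply: filterS2 A1 le1A => k /= A1 /(lt_le_trans A1); rewrite ltxx.
Qed.

Lemma ultra_le_Top A : ultra_le A Top.
Proof. by apply: ultra_leW => k; exact: value_le1. Qed.

Lemma ultra_le_Bot A : ultra_le Bot A.
Proof. by apply: ultra_leW => k; exact: value_ge0. Qed.

Variable F : formula S -> R.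
Hypotheses (F0 : F Bot = 0) (F1 : forall A, ultra_le Top A -> F A = 1)
  (F_half : forall A, ~ ultra_le Top A -> F A <= 2^-1)
  (F_mono : forall A B, ultra_le A B -> F A <= F B).

Let F_eq A B : U [set k | value (v k) A = value (v k) B] -> F A = F B.
Proof.
move=> AB; apply/le_anti/andP.
by split; apply: F_mono; apply: filterS AB => k /= ->.
Qed.

(** By totality, the minimum is attained by the same conjunct for [U]-almost all [k]. *)
Let F_and A B : F (And A B) = Num.min (F A) (F B).
Proof.
have [AB|BA] := ultra_le_total A B.
  rewrite (min_idPl (F_mono AB)); apply: F_eq.
  by apply: filterS AB => k /= /min_idPl.
rewrite (min_idPr (F_mono BA)); apply: F_eq.
by apply: filterS BA => k /= /min_idPr.
Qed.

Let F_or A B : F (Or A B) = Num.max (F A) (F B).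
Proof.
have [AB|BA] := ultra_le_total A B.
  rewrite (max_idPr (F_mono AB)); apply: F_eq.
  by apply: filterS AB => k /= /max_idPr.
rewrite (max_idPl (F_mono BA)); apply: F_eq.
by apply: filterS BA => k /= /max_idPl.
Qed.

(** If [ultra_le A B] fails, the implication has the value of [B] for [U]-almost all [k]. A monotone
    [F] could still identify [A] and [B], which [strict] excludes. *)
Let F_imp A B : (~ ultra_le A B -> F B < F A) ->
  F (Imp A B) = if F A <= F B then 1 else F B.
Proof.
move=> strict; have [AB|nAB] := pselect (ultra_le A B).
  by rewrite (F_mono AB) F1 //; apply: filterS AB => k /= ->.
rewrite leNgt strict //=; apply: F_eq.
have [//|] := in_ultra_setVsetC [set k | value (v k) A <= value (v k) B] U_ultra.
by apply: filterS => k /= /negP/negbTE ->.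
Qed.

(** The gap below 1 ensures that [F A] is 1 only if [A] has value 1 for [U]-almost all [k]. *)
Let F_delta A : F (Delta A) = if F A == 1 then 1 else 0.
Proof.
have [A1|nA1] := pselect (ultra_le Top A).
  rewrite (F1 A1) eqxx F1 //; apply: filterS A1 => k /= A1.
  by rewrite ifT // eq_le value_le1.
rewrite ifF; last first.
  by apply/negbTE/eqP => FA; have := F_half nA1; rewrite FA leNgt invf_lt1 ?ltr1n.
rewrite -F0; apply: F_eq.
have [//|] := in_ultra_setVsetC [set k | 1 <= value (v k) A] U_ultra.
by apply: filterS => k /= /negP nk; rewrite ifF //; apply: contraNF nk => /eqP ->.
Qed.

(** Truth lemma by induction on [A]: the atoms hold by construction of the model, and strictness
    enters only at implications. *)
Lemma herbrand_model_value (F01 : forall A, 0 <= F A <= 1) hs d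
    (w s : nat -> term S) A :
  quantifier_free A ->
  (forall f, funsym_in f A -> hs f) ->
  (forall y, free_in y A -> ground hs d (w y) = s y) ->
  (forall C B, imp_consequents A C -> ~ ultra_le B (subst s C) ->
    F (subst s C) < F B) ->
  @value R S (herbrand_model hs d F01) w A = F (subst s A).
Proof.
elim: A => //= [p a||B IHB C IHC|B IHB C IHC|B IHB C IHC|B IHB] qf hf ws strict.
- congr F; congr Atom; apply/funext => i.
  by apply: ground_term_value => [f fi|y yi]; [apply: hf|apply: ws]; exists i.
- by rewrite F1 //; exact: ultra_leW.
- have [qB qC] := andP qf; rewrite F_and.
  rewrite IHB ?IHC // => *; do ?[by apply: hf; tauto | by apply: ws; tauto];
    by apply: strict => //; ((left; assumption) || (right; assumption)).
- have [qB qC] := andP qf; rewrite F_or.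
  rewrite IHB ?IHC // => *; do ?[by apply: hf; tauto | by apply: ws; tauto];
    by apply: strict => //; ((left; assumption) || (right; assumption)).
- have [qB qC] := andP qf; rewrite F_imp; last by apply: strict; left.
  rewrite IHB ?IHC // => *; do ?[by apply: hf; tauto | by apply: ws; tauto];
    by apply: strict => //; right; ((left; assumption) || (right; assumption)).
- by rewrite F_delta IHB.
Qed.

End Ultralimit.

(** * The Herbrand countermodel *)

Theorem theorem3p4 (R : realType) (S : signature) (c h : funsym S)
  (hc : farity c = 0%N) (hh : (0 < farity h)%N)
  (P : formula S) (m : nat) (xs : m.-tuple nat) (xs_uniq : uniq xs)
  (P_qf : quantifier_free P)
  (P_free : forall y : nat, free_in y P -> y \in (xs : seq nat))
  (P_valid : valid R (exists_closure xs P)) :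
  exists (n : nat) (ts : 'I_n -> m.-tuple (term S)),
    (forall (i : 'I_n) (j : 'I_m), herbrand_universe c h P (tnth (ts i) j)) /\
    valid R (disjunction [seq inst P xs (ts i) | i <- enum 'I_n]).
Proof.
set hs := [set f | herbrand_symbol c h P f].
(* A constant from [P], or else the added [c], yields the closed default term [d]. *)
have [f0 hf0 f0_0] : exists2 f, herbrand_symbol c h P f & farity f = 0%N.
  have [[g gP g0]|nc] := pselect (exists2 g, funsym_in g P & farity g = 0%N).
    by exists g => //; apply: Or31.
  by exists c => //; apply: Or32.
pose d : term S := App (fun i : 'I_(farity f0) => Var 0%N).
have Ud : herbrand_universe c h P d.
  by apply: HerbrandApp => // -[i lt_i]; exfalso; rewrite f0_0 in lt_i.
have [e eU e_surj] := countable_enum (countable_herbrand_universe hf0) Ud.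
(* [k] codes a tuple of indices into [e]; a number that codes none gets the all-zero tuple. *)
pose T k : m.-tuple (term S) :=
  map_tuple e (odflt [tuple of nseq m 0%N] (unpickle k)).
have TU k j : herbrand_universe c h P (tnth (T k) j).
  by rewrite tnth_map; exact: eU.
have T_surj (ts : m.-tuple (term S)) :
    (forall j, herbrand_universe c h P (tnth ts j)) -> exists k, T k = ts.
  move=> tsU; have /choice[g gE] : forall j, exists n, e n = tnth ts j.
    by move=> j; have [n _ <-] := e_surj _ (tsU j); exists n.
  exists (pickle [tuple g j | j < m]); apply/eq_from_tnth => j.
  by rewrite tnth_map pickleK /= tnth_mktuple.
apply: contrapT => no_disj.
have counter k : exists Mv : {M : structure R S & nat -> dom M},
    forall i, (i < k)%N -> value (projT2 Mv) (inst P xs (T i)) < 1.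
  have : ~ valid R (disjunction [seq inst P xs (T i) | i : 'I_k <- enum 'I_k]).
    by move=> valid_k; apply: no_disj; exists k, (fun i => T i).
  move=> /existsNP[M /existsNP[v v1]]; exists (existT _ M v) => i ik /=.
  exact: (value_disjunction_lt1 (i := Ordinal ik) v1 (mem_enum _ _)).
have {no_disj counter} [Mv MvP] := choice counter.
pose M k := projT1 (Mv k); pose v k : nat -> dom (M k) := projT2 (Mv k).
(* Since [U] contains all cofinite sets and instance [i] is below 1 for every [k > i], each instance
   is below 1 for [U]-almost all [k]. *)
have [U [U_ultra U_oo]] := @ultraFilterLemma _ \oo _.
have small i : ~ ultra_le v U Top (inst P xs (T i)).
  apply: ultra_lt; apply: U_oo; exists i.+1 => // k /= ik; exact: MvP.
(* The formulas at which [F] must be strict: the consequents in all Herbrand instances. [Bot] makes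
   the set nonempty for the enumeration. *)
pose X : set (formula S) := [set Bot] `|`
  \bigcup_(k in [set: nat]) ((fun C => inst C xs (T k)) @` imp_consequents P).
have X_countable : countable X.
  apply: countableU => //; apply: bigcup_countable => // k _.
  exact/countable_image/countable_imp_consequents.
have [a _ a_surj] := @countable_enum _ X Bot X_countable (or_introl erefl).
have Top_Bot : ~ ultra_le v U Top Bot.
  by apply: ultra_lt; apply: filterE => k; exact: ltr01.
have [F [F0 F1 F_half F_mono F_strict]] := preorder_embedding R a
  (ultra_le_trans (v := v) U_ultra) (ultra_le_total v U_ultra)
  (ultra_le_Bot v U_ultra) (ultra_le_Top v U_ultra) Top_Bot.
have F01 A : 0 <= F A <= 1.
  rewrite -{1}F0 -(F1 Top); last exact: ultra_leW.
  by rewrite !F_mono //; [exact: (ultra_le_Bot v) | exact: (ultra_le_Top v)].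
pose H := herbrand_model hs d F01.
have H_half (w : nat -> dom H) : value w P <= 2^-1.
  (* Grounding the valuation turns the value of [P] under [w] into [F] of one of the enumerated
     instances. *)
  pose ts := map_tuple (fun y => ground hs d (w y)) xs.
  have [k Tk] : exists k, T k = ts.
    by apply: T_surj => j; rewrite tnth_map; exact: herbrand_universe_ground.
  pose s y := nth (Var y) ts (index y xs).
  rewrite (herbrand_model_value (v := v) U_ultra F0 F1 F_half F_mono F01 (s := s)) //.
  - by apply: F_half; rewrite -[subst s P]/(inst P xs ts) -Tk; exact: small.
  - by move=> f fP; apply: Or31.
  - by move=> y /P_free yxs; rewrite /s (nth_map 0%N) ?index_mem // nth_index.
  - move=> C B PC; have [n _ <-] : range a (subst s C).
      by apply: a_surj; right; exists k => //; exists C => //; rewrite Tk.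
    exact: F_strict.
(* A uniform bound passes to the suprema; strict inequality to 1 at each [w] would not suffice. *)
have := value_exists_closure_le (fun=> Var 0%N : dom H) xs H_half.
by rewrite P_valid leNgt invf_lt1 ?ltr1n.
Qed.
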